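(* If $x\in\mathbb R^2$ and $\operatorname{rank}(G_x)=1$, then $\operatorname{orb}(x)=\{x'\in\mathbb R^2\mid G_{x'}=G_x\}$.
   Context: $\mathcal G_2=GL(2,\mathbb Z)\ltimes\mathbb Z^2$ is the group of affine transformations of $\mathbb R^2$ of the form $x\mapsto Ux+t$, where $t\in\mathbb Z^2$ and $U$ is an integer $2\times2$ matrix with $\det(U)=\pm1$. For $x\in\mathbb R^2$, $\operatorname{orb}(x)=\{y\in\mathbb R^2\mid y=\gamma(x)\text{ for some }\gamma\in\mathcal G_2\}$. For $x=(x_1,x_2)\in\mathbb R^2$, $G_x=\mathbb Z+\mathbb Zx_1+\mathbb Zx_2$ is the subgroup of the additive group $\mathbb R$ generated by $1,x_1,x_2$, and $\operatorname{rank}(G_x)$ is its rank as a free abelian group. Equality $G_{x'}=G_x$ means equality as subsets of $\mathbb R$. *)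

(* Defs.v *)
From mathcomp Require Import all_boot all_order all_algebra.
From mathcomp Require Import boolp classical_sets reals.

Set Implicit Arguments.
Unset Strict Implicit.
Unset Printing Implicit Defensive.

Import Order.TTheory GRing.Theory Num.Theory.
Local Open Scope classical_set_scope.
Local Open Scope ring_scope.

Definition int_affine (R : realType) (U : 'M[int]_2) (t : 'cV[int]_2)
    (x : 'cV[R]_2) : 'cV[R]_2 :=
  map_mx intr U *m x + map_mx intr t.

Definition affine_group2 (R : realType) : set ('cV[R]_2 -> 'cV[R]_2) :=
  [set g | exists (U : 'M[int]_2) (t : 'cV[int]_2),
     (\det U = 1 \/ \det U = -1) /\ g = int_affine U t].

Definition orb (R : realType) (x : 'cV[R]_2) : set 'cV[R]_2 :=
  [set y | exists2 g, affine_group2 g & y = g x].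

Definition int_span (R : realType) (m : nat) (s : m.-tuple R) : set R :=
  [set r | inIntSpan s r].

Definition int_free (R : realType) (m : nat) (s : m.-tuple R) : Prop :=
  forall a : 'I_m -> int, \sum_(i < m) s`_i *~ a i = 0 -> forall i, a i = 0.

(* H is a free abelian group of rank n, i.e. it has a Z-basis of n elements.
   The rank is a relation because H is an arbitrary subset of R; at most one n
   is related to a given H, by invariance of the size of a Z-basis. *)
Definition free_abelian_rank (R : realType) (H : set R) (n : nat) : Prop :=
  exists s : n.-tuple R, int_free s /\ H = int_span s.

Definition coord_group (R : realType) (x : 'cV[R]_2) : set R :=
  int_span [tuple 1; x 0 0; x 1 0].

(* Main.v *)
Require Import Defs.
From mathcomp Require Import all_boot all_order all_algebra.
From mathcomp Require Import boolp classical_sets reals.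
From mathcomp Require Import ring.

Set Implicit Arguments.
Unset Strict Implicit.
Unset Printing Implicit Defensive.

Import Order.TTheory GRing.Theory Num.Theory.
Local Open Scope classical_set_scope.
Local Open Scope ring_scope.

(** If G_x is infinite cyclic, generated by s, then 1 = s d and x = s (p, q)
    with integers d, p, q, and gcd (p, q, d) = 1 because s is itself an integer
    combination of 1 and the coordinates of x.  With g = gcd (p, q), Euclid's
    algorithm provides a matrix of determinant 1 that moves (p, q) to (g, 0).
    The second coordinate may then be translated by 1 = s d, so that (g, 0)
    becomes (g, d); as g and d are coprime, a second application of Euclid's
    algorithm leads to (1, 0).  Hence x lies in the orbit of (s, 0)
    ([orb_generator]), a point that depends on the group G_x alone.  Two points
    with the same group are thus in one orbit, orbits being equivalence classes
    ([orb_trans], [orb_sym]).  Conversely the coordinates of an image of x are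
    integer combinations of 1 and the coordinates of x, so the group can only
    shrink along an orbit, and by symmetry it is constant
    ([orb_coord_group]). *)

Lemma orb_int_affine (R : realType) (U : 'M[int]_2) (t : 'cV[int]_2)
    (x : 'cV[R]_2) :
  \det U = 1 \/ \det U = -1 -> orb x (int_affine U t x).
Proof. by move=> hU; exists (int_affine U t) => //; exists U, t. Qed.

Lemma orb_trans (R : realType) (x y z : 'cV[R]_2) :
  orb x y -> orb y z -> orb x z.
Proof.
move=> [_ [U [t [hU ->]]] ->] [_ [V [s [hV ->]]] ->].
have -> : int_affine V s (int_affine U t x)
    = int_affine (V *m U) (V *m t + s) x.
  by rewrite /int_affine mulmxDr mulmxA map_mxD !map_mxM addrA.
apply: orb_int_affine; rewrite det_mulmx.
by case: hU => ->; case: hV => ->; rewrite ?mulrNN ?mulN1r ?mulr1; auto.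
Qed.

Lemma orb_sym (R : realType) (x y : 'cV[R]_2) : orb x y -> orb y x.
Proof.
move=> [_ [U [t [hU ->]]] ->].
have uU : U \in unitmx.
  by rewrite unitmxE; case: hU => ->; rewrite ?unitrN1 ?unitr1.
have {2}<- : int_affine (invmx U) (- (invmx U *m t)) (int_affine U t x) = x.
  rewrite /int_affine mulmxDr mulmxA -!map_mxM mulVmx // map_mxN map_mx1.
  by rewrite mul1mx addrK.
apply: orb_int_affine; rewrite det_inv.
by case: hU => ->; rewrite ?invrN ?invr1; auto.
Qed.

Lemma coord_groupP (R : realType) (x : 'cV[R]_2) (r : R) :
  coord_group x r <->
  exists a b c : int, r = a%:~R + x 0 0 *~ b + x 1 0 *~ c.
Proof.
split=> [[a ->]|[a [b [c ->]]]].
  exists (a ord0), (a (lift ord0 ord0)), (a (lift ord0 (lift ord0 ord0))).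
  by rewrite !big_ord_recl big_ord0 addr0 /= addrA.
exists [ffun i : 'I_3 => [:: a; b; c]`_i].
by rewrite !big_ord_recl big_ord0 !ffunE addr0 /= addrA.
Qed.

Lemma int_span1P (R : realType) (s : 1.-tuple R) (r : R) :
  int_span s r <-> exists a : int, r = s`_0 *~ a.
Proof.
split=> [[a ->]|[a ->]].
  by exists (a 0); rewrite big_ord_recl big_ord0 addr0.
by exists [ffun=> a]; rewrite big_ord_recl big_ord0 ffunE addr0.
Qed.

Lemma int_affine_coord (R : realType) (U : 'M[int]_2) (t : 'cV[int]_2)
    (x : 'cV[R]_2) (i : 'I_2) :
  int_affine U t x i 0 = x 0 0 *~ U i 0 + x 1 0 *~ U i 1 + (t i 0)%:~R.
Proof.
rewrite !mxE !big_ord_recl big_ord0 !mxE addr0.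
rewrite -[x 0 0 *~ _]mulrzl -[x 1 0 *~ _]mulrzl.
by have <- : lift ord0 ord0 = 1 :> 'I_2 by apply/val_inj.
Qed.

Lemma sub_coord_group_orb (R : realType) (x y : 'cV[R]_2) :
  orb x y -> coord_group y `<=` coord_group x.
Proof.
move=> [_ [U [t [_ ->]]] ->] r /coord_groupP[a [b [c ->]]].
apply/coord_groupP; rewrite !int_affine_coord.
exists (a + t 0 0 * b + t 1 0 * c), (U 0 0 * b + U 1 0 * c).
exists (U 0 1 * b + U 1 1 * c).
ring.
Qed.

Lemma orb_coord_group (R : realType) (x y : 'cV[R]_2) :
  orb x y -> coord_group y = coord_group x.
Proof.
move=> xy; apply/seteqP; split; first exact: sub_coord_group_orb.
exact/sub_coord_group_orb/orb_sym.
Qed.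

Definition int_multiples (R : realType) (s : R) (p q : int) : 'cV[R]_2 :=
  \col_i (s *~ [:: p; q]`_i).

Lemma orb_int_multiples (R : realType) (s : R) (a b c d t0 t1 p q p' q' : int) :
  a * d - b * c = 1 ->
  s *~ p' = s *~ (a * p + b * q) + t0%:~R ->
  s *~ q' = s *~ (c * p + d * q) + t1%:~R ->
  orb (int_multiples s p q) (int_multiples s p' q').
Proof.
move=> hdet hp' hq'.
pose U : 'M[int]_2 := \matrix_(i, j) [:: [:: a; b]`_j; [:: c; d]`_j]`_i.
pose t : 'cV[int]_2 := \col_i [:: t0; t1]`_i.
have -> : int_multiples s p' q' = int_affine U t (int_multiples s p q).
  apply/matrixP=> i j; rewrite (ord1 j) int_affine_coord !mxE /=.
  have [->|->] : i = 0 \/ i = 1.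
    by case: i => [[|[|]]] //= hi; [left|right]; apply/val_inj.
  - by rewrite /= hp' mulrzDr mulrC [b * q]mulrC !mulrzA.
  - by rewrite /= hq' mulrzDr mulrC [d * q]mulrC !mulrzA.
apply: orb_int_affine; left; rewrite (expand_det_row _ ord0).
rewrite !big_ord_recl big_ord0 /cofactor !det_mx11 !mxE /=.
by rewrite expr0 expr1 mul1r mulN1r mulrN addr0.
Qed.

(** The first row of the matrix consists of Bezout coefficients of p and q; the
    second row (- q / g, p / g), where g is the gcd, annihilates (p, q) and makes
    the determinant 1.  When g = 0 both points are the origin. *)
Lemma orb_gcd (R : realType) (s : R) (p q : int) :
  orb (int_multiples s p q) (int_multiples s (gcdz p q) 0).
Proof.
move: (gcdz p q) (Bezoutz p q) (dvdz_gcdl p q) (dvdz_gcdr p q).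
move=> g [u [v uv]] /dvdzP[p' hp] /dvdzP[q' hq]; rewrite {}hp {}hq in uv *.
have [->|g0] := eqVneq g 0.
  by apply: (@orb_int_multiples _ _ 1 0 0 1 0 0); rewrite ?mulr0 ?addr0.
apply: (@orb_int_multiples _ _ u v (- q') p' 0 0); rewrite ?addr0 ?uv //.
  by apply: (mulIf g0); rewrite mul1r -[RHS]uv; ring.
by congr (_ *~ _); ring.
Qed.

(** The point (s, 0) serves as a normal form: it depends on x only through the
    group, so it can be shared by all the points with that group. *)
Lemma orb_generator (R : realType) (x : 'cV[R]_2) (s : R) :
  (forall r, coord_group x r <-> exists a : int, r = s *~ a) ->
  orb x (int_multiples s 1 0).
Proof.
move=> hG.
have [d hd] : exists d : int, 1 = s *~ d.
  by apply/hG/coord_groupP; exists 1, 0, 0; rewrite !mulr0z !addr0.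
have [p hp] : exists p : int, x 0 0 = s *~ p.
  by apply/hG/coord_groupP; exists 0, 1, 0; rewrite mulr0z !addr0 add0r.
have [q hq] : exists q : int, x 1 0 = s *~ q.
  by apply/hG/coord_groupP; exists 0, 0, 1; rewrite mulr0z !add0r.
have s0 : s != 0 by apply: contra_eq_neq hd => ->; rewrite mul0rz oner_neq0.
have -> : x = int_multiples s p q.
  apply/matrixP=> i j; rewrite (ord1 j) mxE.
  by case: i => [[|[|]]] //= hi; rewrite -?hp -?hq; congr (x _ _); apply/val_inj.
have [a [b [c habc]]] : exists a b c : int, a * d + b * p + c * q = 1.
  have /coord_groupP[a [b [c e]]] : coord_group x s by apply/hG; exists 1.
  exists a, b, c; apply: (@intr_inj R); apply: (mulfI s0).
  have ha : a%:~R = s *~ d *~ a by rewrite -hd.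
  by rewrite mulr1 [RHS]e hp hq ha; ring.
set g := gcdz p q.
have gd1 : gcdz g d = 1.
  have : (gcdz g d %| (a * d + b * p + c * q)%R)%Z.
    have [hp' hq'] := (dvdz_gcdl p q, dvdz_gcdr p q).
    apply: rpredD; [apply: rpredD|]; apply: dvdz_mull.
    - exact: dvdz_gcdr.
    - exact: dvdz_trans (dvdz_gcdl _ _) hp'.
    - exact: dvdz_trans (dvdz_gcdl _ _) hq'.
  by rewrite habc dvdz1 /gcdz /= => /eqP->.
apply: (orb_trans (orb_gcd s p q)); rewrite -/g.
(* Although g may differ from 1, replacing the second coordinate 0 by 1 = s d
   makes the two multipliers coprime. *)
apply: (@orb_trans _ _ (int_multiples s g d)); last first.
  by rewrite -gd1; exact: orb_gcd.
apply: (@orb_int_multiples _ _ 1 0 0 1 0 1);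
  rewrite ?mulr0 ?mul0r ?mul1r ?addr0 //.
by rewrite mulr0z add0r -hd.
Qed.

Theorem proposition2p3 (R : realType) (x : 'cV[R]_2)
    (hx : free_abelian_rank (coord_group x) 1) :
  orb x = [set x' : 'cV[R]_2 | coord_group x' = coord_group x].
Proof.
apply/seteqP; split=> [y|y /= hy]; first exact: orb_coord_group.
have [s [_ hG]] := hx.
apply: (@orb_trans _ _ (int_multiples s`_0 1 0)).
  by apply: orb_generator => r; rewrite hG; exact: int_span1P.
by apply/orb_sym/orb_generator => r; rewrite hy hG; exact: int_span1P.
Qed.
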